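(* For all nonzero integers $p,q$, the Baumslag-Solitar group $BS_q^p=\langle x,t\mid x^p=t x^q t^{-1}\rangle$, regarded as a discrete group, is a-T-menable.
   Context: A locally compact, second countable, compactly generated group $L$ (in particular, a finitely generated discrete group) is a-T-menable if there exists a metrically proper (continuous) affine isometric action of $L$ on some Hilbert space $\mathcal{H}$. Metrically proper means that for every $v\in\mathcal{H}$ and every $r>0$ the set $\{g\in L : \|g\cdot v\|\le r\}$ is relatively compact in $L$ (finite, when $L$ is discrete). *)

(* Defs.v *)
From HB Require Import structures.
From mathcomp Require Import all_boot all_order all_algebra sesquilinear.
From mathcomp Require Import all_classical all_reals topology normedtype.

Set Implicit Arguments.
Unset Strict Implicit.
Unset Printing Implicit Defensive.

Import Order.TTheory GRing.Theory Num.Theory.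
Import numFieldNormedType.Exports.

Local Open Scope classical_set_scope.
Local Open Scope quotient_scope.
Local Open Scope ring_scope.

(* Words in the letters a (coded (a, true)) and a^-1 (coded (a, false)). *)
Definition word (T : Type) : Type := seq (T * bool).

Definition invw (T : Type) (w : word T) : word T :=
  rev [seq (l.1, ~~ l.2) | l <- w].

Definition expw (T : Type) (w : word T) (n : int) : word T :=
  match n with
  | Posz k => flatten (nseq k w)
  | Negz k => flatten (nseq k.+1 (invw w))
  end.

(* The congruence on words generated by free cancellation and by the relations
   u = v for rels u v; its classes form the group < T | rels >. *)
Inductive pres_eq (T : Type) (rels : word T -> word T -> Prop) :
    word T -> word T -> Prop :=
| pres_refl u : pres_eq rels u u
| pres_sym u v : pres_eq rels u v -> pres_eq rels v u
| pres_trans u v w : pres_eq rels u v -> pres_eq rels v w -> pres_eq rels u w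
| pres_cat u v u' v' : pres_eq rels u v -> pres_eq rels u' v' ->
    pres_eq rels (u ++ u') (v ++ v')
| pres_cancel a b : pres_eq rels [:: (a, b); (a, ~~ b)] [::]
| pres_rel u v : rels u v -> pres_eq rels u v.

Section PresentedGroup.
Variables (T : choiceType) (rels : word T -> word T -> Prop).

Definition pres_eqb (u v : seq (T * bool)) : bool := `[< pres_eq rels u v >].

Lemma pres_eqb_refl : reflexive pres_eqb.
Proof. by move=> u; apply/asboolP; exact: pres_refl. Qed.

Lemma pres_eqb_sym : symmetric pres_eqb.
Proof. by move=> u v; apply/asboolP/asboolP; exact: pres_sym. Qed.

Lemma pres_eqb_trans : transitive pres_eqb.
Proof.
by move=> v u w /asboolP uv /asboolP vw; apply/asboolP; exact: pres_trans uv vw.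
Qed.

Canonical pres_equiv : equiv_rel (seq (T * bool)) :=
  EquivRel pres_eqb pres_eqb_refl pres_eqb_sym pres_eqb_trans.

Definition presented : Type := {eq_quot pres_equiv}.
HB.instance Definition _ := Choice.on presented.
HB.instance Definition _ := EqQuotient.on presented.

Lemma presentedP (u v : seq (T * bool)) :
  reflect (\pi_presented u = \pi_presented v) `[< pres_eq rels u v >].
Proof.
apply: (iffP idP) => [uv|/eqquotP //].
exact/eqquotP.
Qed.

Lemma pres_invr (u : word T) : pres_eq rels (u ++ invw u) [::].
Proof.
elim: u => [|[a b] u IH]; first exact: pres_refl.
have E : ((a, b) :: u) ++ invw ((a, b) :: u) =
          [:: (a, b)] ++ (u ++ invw u) ++ [:: (a, ~~ b)].
  by rewrite /invw /= rev_cons -cats1 -catA.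
rewrite [_ ++ _]E.
apply: pres_trans (pres_cancel rels a b).
apply: (@pres_cat _ _ [:: (a, b)] [:: (a, b)]); first exact: pres_refl.
apply: (@pres_cat _ _ _ [::] _ [:: (a, ~~ b)]) => //; exact: pres_refl.
Qed.

Lemma invwK : involutive (@invw T).
Proof.
move=> u; rewrite /invw map_rev revK -map_comp -[RHS]map_id.
by apply: eq_map => -[a b] /=; rewrite negbK.
Qed.

Lemma pres_invl (u : word T) : pres_eq rels (invw u ++ u) [::].
Proof. by rewrite -{2}[u]invwK; exact: pres_invr. Qed.

Lemma pres_inv (u v : word T) :
  pres_eq rels u v -> pres_eq rels (invw u) (invw v).
Proof.
move=> uv; apply: (@pres_trans _ _ _ (invw u ++ (v ++ invw v))).
  rewrite -{1}[invw u]cats0; apply: pres_cat; first exact: pres_refl.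
  exact/pres_sym/pres_invr.
rewrite catA -[X in pres_eq _ _ X]cat0s.
apply: pres_cat; last exact: pres_refl.
apply: pres_trans (pres_invl u).
by apply: pres_cat; [exact: pres_refl | exact: pres_sym].
Qed.

Definition presented_mul (g h : presented) : presented :=
  \pi_presented (repr g ++ repr h).
Definition presented_inv (g : presented) : presented :=
  \pi_presented (invw (repr g)).
Definition presented_one : presented := \pi_presented [::].

Lemma repr_presented (u : seq (T * bool)) :
  pres_eq rels (repr (\pi_presented u)) u.
Proof. by apply/asboolP/presentedP; rewrite reprK. Qed.

Lemma presented_mulE (u v : seq (T * bool)) :
  presented_mul (\pi_presented u) (\pi_presented v) = \pi_presented (u ++ v).
Proof.
by apply/presentedP/asboolP; apply: pres_cat; exact: repr_presented.
Qed.

Lemma presented_invE (u : seq (T * bool)) :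
  presented_inv (\pi_presented u) = \pi_presented (invw u).
Proof. by apply/presentedP/asboolP; exact/pres_inv/repr_presented. Qed.

Lemma presented_mulA : associative presented_mul.
Proof.
elim/quotW=> u; elim/quotW=> v; elim/quotW=> w.
by rewrite (presented_mulE u v) (presented_mulE v w) !presented_mulE catA.
Qed.

Lemma presented_mul1g : left_id presented_one presented_mul.
Proof. by elim/quotW=> u; rewrite presented_mulE. Qed.

Lemma presented_mulg1 : right_id presented_one presented_mul.
Proof. by elim/quotW=> u; rewrite presented_mulE cats0. Qed.

Lemma presented_mulV :
  left_inverse presented_one presented_inv presented_mul.
Proof.
elim/quotW=> u; rewrite presented_invE presented_mulE.
by apply/presentedP/asboolP; exact: pres_invl.
Qed.

Lemma presented_mulVr :
  right_inverse presented_one presented_inv presented_mul.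
Proof.
elim/quotW=> u; rewrite presented_invE presented_mulE.
by apply/presentedP/asboolP; exact: pres_invr.
Qed.

HB.instance Definition _ := isGroup.Build presented
  presented_mulA presented_mul1g presented_mulg1 presented_mulV presented_mulVr.

End PresentedGroup.

(* Generators of the Baumslag-Solitar group: x is true, t is false. *)
Definition wx : word bool := [:: (true, true)].
Definition wt : word bool := [:: (false, true)].

Definition BS_rel (p q : int) (u v : word bool) : Prop :=
  u = expw wx p /\ v = wt ++ expw wx q ++ invw wt.

(* BS p q = < x, t | x^p = t x^q t^-1 > *)
Definition BS (p q : int) : groupType := presented (BS_rel p q).

(* Makes a complete normed space a real Hilbert space. *)
Definition induces_norm (R : realType) (H : completeNormedModType R)
    (dot : {dot H for idfun}) : Prop :=
  forall v : H, `|v| ^+ 2 = dot v v.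

Definition is_action (L : groupType) (H : Type) (act : L -> H -> H) : Prop :=
  (forall v, act 1%g v = v) /\
  (forall g h v, act (g * h)%g v = act g (act h v)).

Definition affine (R : realType) (H : lmodType R) (f : H -> H) : Prop :=
  forall (a : R) (u v : H),
    f (a *: u + (1 - a) *: v) = a *: f u + (1 - a) *: f v.

Definition isometric (R : realType) (H : normedModType R) (f : H -> H) : Prop :=
  forall u v : H, `|f u - f v| = `|u - v|.

(* L is discrete: relatively compact subsets are the finite ones. *)
Definition metrically_proper (R : realType) (L : groupType)
    (H : normedModType R) (act : L -> H -> H) : Prop :=
  forall (v : H) (r : R), 0 < r -> finite_set [set g : L | `|act g v| <= r].

(* a-T-menability of L with the discrete topology, for which continuity of the
   action is just continuity of each isometry act g, hence automatic. A complex
   Hilbert space is a real one with the same norm, and complex affine maps are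
   real affine, so real scalars lose no generality. *)
Definition a_T_menable (R : realType) (L : groupType) : Prop :=
  exists (H : completeNormedModType R) (dot : {dot H for idfun})
         (act : L -> H -> H),
    [/\ induces_norm dot,
        is_action act,
        forall g, affine (act g) /\ isometric (act g)
      & metrically_proper act].

(* Main.v *)
Require Import Defs.
From HB Require Import structures.
From mathcomp Require Import all_boot all_order all_algebra sesquilinear finmap.
From mathcomp Require Import all_classical all_reals topology normedtype.
From mathcomp Require Import lra ring zify.
From mathcomp Require Import summability.

(** An affine isometric action of a discrete group is metrically proper as soon
    as the orbit of one vector is.  Such actions are obtained here from a group
    L acting on a set I and a function F : I -> R, in general not square
    summable, all of whose translates differ from F by square summable
    functions.  The affine space F + l2(I) is then L-invariant, and the action
    on l2(I) is proper when the norms of F . g^-1 - F tend to infinity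
    (a_T_menable_of_coboundary).

    For BS p q the set I has two parts, which reflect the fact that the group
    sits discretely in the product of the automorphism group of its Bass-Serre
    tree and of the affine group of the line.

    First, I contains the pairs of vertices of the Bass-Serre tree, and F is the
    indicator of the edges that point away from a base vertex.  Moving the base
    vertex flips exactly the edges of a geodesic, so the norm of F . g^-1 - F
    bounds the displacement of the base vertex (coboundary_base_le).  The tree is
    locally finite, because p and q are nonzero, and the stabilizer of the base
    vertex is generated by x; so a bound on the norm leaves finitely many cosets
    c <x> (finite_ball, coset_of_vertex).

    Second, the powers of x are handled by the homomorphism to the semidirect
    product of Q by Z that sends x to the translation by 1 in Q and t to the
    generator of Z, which multiplies Q by p / q.  This solvable group is amenable:
    it has finite sets A_m that are almost invariant under x and t, written
    explicitly as rectangles of a grid.  The part nat * (int * rat) of I holds one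
    copy of the group for each m, and F is on the m-th copy a multiple of the
    indicator of A_m.  The multiples are such that the
    differences under x and t have square norms O(2^-m), hence are summable
    (bump_weight_x, bump_weight_t), whereas F has square norm 2^m on the m-th
    copy (bump_norm).  A large power of x moves A_m off itself, so the norm of
    its coboundary exceeds any given bound (coboundary_gX_finite).

    Together, the two parts leave finitely many elements below any bound
    (coboundary_proper). *)

Set Implicit Arguments.
Unset Strict Implicit.
Unset Printing Implicit Defensive.

Import Order.TTheory GRing.Theory Num.Theory.
Import numFieldNormedType.Exports.

Local Open Scope classical_set_scope.
Local Open Scope ring_scope.
Local Open Scope quotient_scope.

(** * The Hilbert space of square summable functions *)

Local Existing Instance totally_filter.

Section SquareSummable.
Variables (R : realType) (I : choiceType).
Implicit Types (f g : I -> R) (J K : {fset I}) (M : R).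

(** The inner product of f and g is the limit of these sums along the filter of
    finite subsets of I. *)
Definition psum f g J : R := \sum_(i <- J) f i * g i.

Definition sq_bounded M f := forall J, psum f f J <= M.

Definition l2_pred : {pred I -> R} := fun f => `[< exists M, sq_bounded M f >].

Lemma psumC f g J : psum f g J = psum g f J.
Proof. by apply: eq_bigr => i _; rewrite mulrC. Qed.

Lemma psum_ge0 f J : 0 <= psum f f J.
Proof. by apply: sumr_ge0 => i _; rewrite -expr2 sqr_ge0. Qed.

Lemma psumDl f g h J : psum (f + g) h J = psum f h J + psum g h J.
Proof. by rewrite -big_split; apply: eq_bigr => i _; exact: mulrDl. Qed.

Lemma psumZl (a : R) f g J : psum (a *: f) g J = a * psum f g J.
Proof. by rewrite mulr_sumr; apply: eq_bigr => i _; exact/esym/mulrA. Qed.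

Lemma psum_le f J K : (J `<=` K)%fset -> psum f f J <= psum f f K.
Proof.
move=> JK; rewrite /psum (big_fsetID _ (mem J) K) /=.
have -> : [fset x in K | x \in J]%fset = J.
  apply/fsetP => i; rewrite !inE /= andbC.
  by case: (boolP (i \in J)) => //= /(fsubsetP JK).
by rewrite lerDl; apply: sumr_ge0 => i _; rewrite -expr2 sqr_ge0.
Qed.

(** Parallelogram identity, with the square of f - g dropped. *)
Lemma sq_boundedD M N f g :
  sq_bounded M f -> sq_bounded N g -> sq_bounded (2 * M + 2 * N) (f + g).
Proof.
move=> fM gN J; have := psum_ge0 (f - g) J.
have := fM J; have := gN J.
have E : psum (f + g) (f + g) J + psum (f - g) (f - g) J
    = 2 * psum f f J + 2 * psum g g J.
  rewrite /psum !mulr_sumr -!big_split; apply: eq_bigr => i _ /=.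
  rewrite !fctE /=; ring.
lra.
Qed.

Fact l2_submod_closed : submod_closed l2_pred.
Proof.
split=> [|a f g /asboolP[M fM] /asboolP[N gN]]; apply/asboolP.
  by exists 0 => J; rewrite /psum big1 // => i _; rewrite mul0r.
exists (2 * (a ^+ 2 * M) + 2 * N); apply: sq_boundedD gN => J.
rewrite psumZl psumC psumZl mulrA -expr2.
by apply: ler_wpM2l; rewrite ?sqr_ge0.
Qed.

HB.instance Definition _ :=
  GRing.isSubmodClosed.Build R (I -> R) l2_pred l2_submod_closed.

Record l2 := L2 { l2val :> I -> R; l2valP : l2val \in l2_pred }.
HB.instance Definition _ := [isSub for l2val].
HB.instance Definition _ := [Choice of l2 by <:].
HB.instance Definition _ := [SubChoice_isSubLmodule of l2 by <:].

Lemma l2P (u : l2) : exists M, sq_bounded M u.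
Proof. exact/asboolP/l2valP. Qed.

(** The sums of squares increase with J, so that boundedness gives convergence. *)
Lemma psum_cvg_sup f : f \in l2_pred ->
  psum f f @ totally --> sup (range (psum f f)).
Proof.
move=> /asboolP[M fM].
have hs : has_sup (range (psum f f)).
  by split; [exists (psum f f fset0); exists fset0|exists M => _ [J _ <-]].
apply/cvgrPdist_lt => e e0.
have [_ [J _ <-] eJ] := sup_adherent e0 hs.
exists J => // K /= /(psum_le f) JK; rewrite ger0_norm ?subr_ge0.
  lra.
by apply: (ub_le_sup hs.2); exists K.
Qed.

(** By polarization from the sums of squares. *)
Lemma psum_cvg (u v : l2) : cvg (psum u v @ totally).
Proof.
have -> : psum u v = fun J =>
    2^-1 * (psum (u + v : l2) (u + v : l2) J - psum u u J - psum v v J).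
  apply/funext => J; rewrite /= !psumDl !(psumC _ (_ + _)) !psumDl (psumC v u).
  by field.
apply/cvg_ex; eexists; apply: cvgM; first exact: cvg_cst.
by apply: cvgB; [apply: cvgB|]; apply: psum_cvg_sup; exact: l2valP.
Qed.

Definition l2dot (u v : l2) : R := lim (psum u v @ totally).

Lemma l2dotC u v : l2dot u v = l2dot v u.
Proof.
rewrite /l2dot (_ : psum u v = psum v u) //.
by apply/funext => J; rewrite psumC.
Qed.

Lemma l2dotDl a u v w : l2dot (a *: u + v) w = a * l2dot u w + l2dot v w.
Proof.
apply: cvg_lim => //.
have -> : psum (a *: u + v : l2) w = fun J => a * psum u w J + psum v w J.
  by apply/funext => J; rewrite /= psumDl psumZl.
apply: cvgD; last exact: psum_cvg.
by apply: cvgM; [exact: cvg_cst|exact: psum_cvg].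
Qed.

Lemma l2dotDr a u v w : l2dot w (a *: u + v) = a * l2dot w u + l2dot w v.
Proof. by rewrite !(l2dotC w) l2dotDl. Qed.

Lemma psum_le_l2dot (u : l2) J : psum u u J <= l2dot u u.
Proof.
apply: limr_ge; first exact: psum_cvg.
by exists J => // K /= JK; exact: psum_le.
Qed.

Lemma l2dot_le (u : l2) M : sq_bounded M u -> l2dot u u <= M.
Proof.
move=> uM; apply: limr_le; first exact: psum_cvg.
by exists fset0 => // K _; exact: uM.
Qed.

Lemma l2dot_ge0 u : 0 <= l2dot u u.
Proof. exact: le_trans (psum_ge0 u fset0) (psum_le_l2dot u fset0). Qed.

Lemma sqr_le_l2dot (u : l2) i : u i ^+ 2 <= l2dot u u.
Proof.
by apply: le_trans (psum_le_l2dot u [fset i]%fset); rewrite /psum big_seq_fset1.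
Qed.

Lemma l2dot_gt0 u : u != 0 -> 0 < l2dot u u.
Proof.
apply: contraNT; rewrite -leNgt => u0; apply/eqP/val_inj/funext => i /=.
have := le_trans (sqr_le_l2dot u i) u0.
by rewrite le_eqVlt ltNge sqr_ge0 orbF sqrf_eq0 => /eqP.
Qed.

Lemma l2dot0l u : l2dot 0 u = 0.
Proof.
by have := l2dotDl (-1) 0 0 u; rewrite scaler0 addr0 mulN1r addNr.
Qed.

Lemma l2dotZl a u v : l2dot (a *: u) v = a * l2dot u v.
Proof. by have := l2dotDl a u 0 v; rewrite !addr0 l2dot0l addr0. Qed.

Definition l2norm (u : l2) : R := Num.sqrt (l2dot u u).

Lemma sqr_l2norm u : l2norm u ^+ 2 = l2dot u u.
Proof. by rewrite sqr_sqrtr ?l2dot_ge0. Qed.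

(** Cauchy-Schwarz: the square norm of |u| v - |v| u is nonnegative. *)
Lemma l2dot_le_norm u v : l2dot u v <= l2norm u * l2norm v.
Proof.
have [->|u0] := eqVneq u 0; first by rewrite l2dot0l mulr_ge0 ?sqrtr_ge0.
have [->|v0] := eqVneq v 0.
  by rewrite l2dotC l2dot0l mulr_ge0 ?sqrtr_ge0.
have pu : 0 < l2norm u by rewrite sqrtr_gt0 l2dot_gt0.
have pv : 0 < l2norm v by rewrite sqrtr_gt0 l2dot_gt0.
have := l2dot_ge0 ((- l2norm v) *: u + l2norm u *: v).
rewrite l2dotDl !l2dotDr !l2dotZl !(l2dotC _ (_ *: _)) !l2dotZl.
rewrite -!sqr_l2norm (l2dotC v u) => h.
rewrite -(ler_pM2l (mulr_gt0 pu pv)) -subr_ge0; nra.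
Qed.

Fact l2norm_triangle u v : l2norm (u + v) <= l2norm u + l2norm v.
Proof.
rewrite -(@ler_pXn2r _ 2) ?nnegrE ?addr_ge0 ?sqrtr_ge0 //.
have D w : l2dot (u + v) w = l2dot u w + l2dot v w.
  by have := l2dotDl 1 u v w; rewrite scale1r mul1r.
rewrite sqrrD !sqr_l2norm D !(l2dotC _ (u + v)) !D (l2dotC v u).
have := l2dot_le_norm u v; lra.
Qed.

Fact l2normZ (a : R) u : l2norm (a *: u) = `|a| * l2norm u.
Proof.
rewrite /l2norm l2dotZl l2dotC l2dotZl mulrA -expr2.
by rewrite sqrtrM ?sqr_ge0 // sqrtr_sqr.
Qed.

Fact l2norm_eq0 u : l2norm u = 0 -> u = 0.
Proof.
move=> u0; apply/eqP/contraT => /l2dot_gt0.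
by rewrite -sqr_l2norm u0 expr0n ltxx.
Qed.

HB.instance Definition _ :=
  @Lmodule_isNormed.Build R l2 l2norm l2norm_triangle l2normZ l2norm_eq0.

Lemma sqr_norm_l2 (u : l2) : `|u| ^+ 2 = l2dot u u.
Proof. exact: sqr_l2norm. Qed.

Lemma sq_bounded_norm (u : l2) : sq_bounded (`|u| ^+ 2) u.
Proof. by move=> J; rewrite sqr_norm_l2 psum_le_l2dot. Qed.

Lemma norm_l2_le (u : l2) (e : R) : 0 <= e -> sq_bounded (e ^+ 2) u -> `|u| <= e.
Proof.
by move=> e0 /l2dot_le; rewrite -sqr_norm_l2 ler_pXn2r ?nnegrE.
Qed.

Lemma norm_coord_l2 (u : l2) i : `|u i| <= `|u|.
Proof.
rewrite -(@ler_pXn2r _ 2) ?nnegrE // real_normK ?num_real //.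
by rewrite sqr_norm_l2 sqr_le_l2dot.
Qed.

(** A Cauchy filter converges coordinatewise.  The bounds on finite partial sums
    pass to the coordinatewise limit, which makes it a limit in norm. *)
Fact l2_complete (F : set_system l2) : ProperFilter F -> cauchy F -> cvg F.
Proof.
move=> FF /cauchyP Fc.
have cc i : cvg ((fun u : l2 => u i) @ F).
  apply: cauchy_cvg; apply: cauchy_exP => e /Fc[u Fu]; exists (u i).
  have sub : ball u e `<=` [set v : l2 | ball (u i) e (v i)].
    move=> v; rewrite -!ball_normE /=.
    exact/le_lt_trans/(norm_coord_l2 (u - v)).
  exact: filterS sub Fu.
pose l i := lim ((fun u : l2 => u i) @ F).
have close e (u : l2) : 0 < e -> F (ball u e) ->
    sq_bounded (e ^+ 2) ((u : I -> R) - l).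
  move=> e0 Fu J.
  pose D (v : l2) := \sum_(i <- J) (u i - v i) * (u i - v i).
  have Dl : D v @[v --> F] --> \sum_(i <- J) (u i - l i) * (u i - l i).
    apply: (cvg_big (@add_continuous R^o)) => i _.
    have h : u i - v i @[v --> F] --> u i - l i.
      by apply: cvgB; [exact: cvg_cst|exact: cc].
    exact: (cvgM h h).
  rewrite -[X in X <= _](_ : lim (D @ F) = _); last exact: (cvg_lim _ Dl).
  apply: limr_le.
    by apply/cvg_ex; eexists; exact: Dl.
  apply: filterS Fu => v; rewrite -ball_normE /= => uv.
  apply: le_trans (sq_bounded_norm (u - v) J) _.
  by rewrite ler_pXn2r ?nnegrE // ltW.
have lS : l \in l2_pred.
  have [u Fu] := Fc 1 ltr01.
  rewrite -[l](subKr (u : I -> R)); apply: rpredB; first exact: l2valP.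
  by apply/asboolP; exists (1 ^+ 2); apply: close.
apply/cvg_ex; exists (L2 lS); apply/cvgrPdist_le => e e0.
have e2 : 0 < e / 2 by rewrite divr_gt0.
have [u Fu] := Fc _ e2.
apply: filterS (Fu) => v; rewrite -ball_normE /= => uv.
have ul : `|u - L2 lS| <= e / 2.
  by apply: norm_l2_le; [exact: ltW|exact: close].
have := ler_normD (L2 lS - u) (u - v).
rewrite addrA subrK (distrC _ u); lra.
Qed.

HB.instance Definition _ := Uniform_isComplete.Build l2 l2_complete.

Fact l2dot_bilinear : bilinear_for *%R (idfun \; *%R) l2dot.
Proof. by split=> [v a u w|v a u w]; [exact: l2dotDl|exact: l2dotDr]. Qed.

HB.instance Definition _ := bilinear_isBilinear.Build R l2 l2 R
  *%R (idfun \; *%R) l2dot l2dot_bilinear.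

Fact l2dot_sym u v : l2dot u v = (-1) ^+ false * idfun (l2dot v u).
Proof. by rewrite expr0 mul1r l2dotC. Qed.

HB.instance Definition _ := isHermitianSesquilinear.Build R l2 false idfun
  l2dot l2dot_sym.
HB.instance Definition _ := isDotProduct.Build R l2 l2dot l2dot_gt0.

Lemma l2_hilbert : induces_norm (H := l2) (l2dot : {dot l2 for idfun}).
Proof. exact: sqr_norm_l2. Qed.

End SquareSummable.

Section Layers.
Variables (R : realType) (I : choiceType).
Implicit Types (f : I -> R) (s : seq I).

Lemma sum_count_mem_le (r s : seq I) :
  uniq r -> (\sum_(i <- r) count_mem i s <= size s)%N.
Proof.
move=> r_uniq; elim: s => [|a s IHs] /=; first by rewrite big1.
rewrite big_split /= -add1n leq_add //.
rewrite (_ : (\sum_(i <- r) (a == i) = count_mem a r)%N).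
  by rewrite count_uniq_mem // leq_b1.
rewrite -sum1_count [RHS]big_mkcond; apply: eq_bigr => i _ /=.
by rewrite eq_sym; case: eqP.
Qed.

(** Square summability from a sequence of finite supports: S m is a list with
    possible repetitions which carries values of square at most w m.  The lists
    may overlap, and the sum over m of size (S m) * w m bounds the square norm. *)
Lemma sq_bounded_layers M f (S : nat -> seq I) (w : nat -> R) :
  (forall m, 0 <= w m) ->
  (forall i, f i != 0 -> exists m, i \in S m /\ f i ^+ 2 <= w m) ->
  (forall n, \sum_(m < n) w m *+ size (S m) <= M) ->
  sq_bounded M f.
Proof.
move=> w0 fS wM J.
have /choice[mu muP] : forall i, exists m,
    f i != 0 -> i \in S m /\ f i ^+ 2 <= w m.
  by move=> i; have [->|/fS[m mP]] := eqVneq (f i) 0; [exists 0|exists m].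
pose n := (\max_(i <- J) mu i).+1.
apply: le_trans (wM n).
have -> : \sum_(m < n) w m *+ size (S m) =
    \sum_(0 <= m < n) w m *+ size (S m) by rewrite big_mkord.
apply: (@le_trans _ _ (\sum_(i <- J) \sum_(0 <= m < n) w m *+ count_mem i (S m))).
  rewrite /psum big_seq [leRHS]big_seq; apply: ler_sum => i iJ.
  have [->|fi] := eqVneq (f i) 0.
    by rewrite mul0r sumr_ge0 // => m _; rewrite mulrn_wge0.
  have [iS fw] := muP i fi.
  have mun : mu i \in index_iota 0 n.
    by rewrite mem_index_iota /= ltnS (leq_bigmax_seq (P := predT)).
  rewrite (big_rem _ mun) /= -expr2; apply: le_trans fw _.
  rewrite -[leLHS]addr0 lerD //; last first.
    by apply: sumr_ge0 => m _; rewrite mulrn_wge0.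
  by rewrite -[leLHS]mulr1n ler_wpMn2l // -has_count has_pred1.
rewrite exchange_big /=; apply: ler_sum => m _.
by rewrite sumrMnr ler_wpMn2l // sum_count_mem_le.
Qed.

Lemma sq_bounded_uniq M f s :
  sq_bounded M f -> uniq s -> \sum_(i <- s) f i ^+ 2 <= M.
Proof.
move=> fM s_uniq; apply: le_trans (fM [fset i in s]%fset).
rewrite le_eqVlt; apply/orP; left; apply/eqP/perm_big/uniq_perm => // i.
by rewrite !inE.
Qed.

End Layers.

(** * Affine actions from functions with square summable coboundary *)

Section AffineAction.
Variables (R : realType) (I : choiceType) (L : groupType) (op : L -> I -> I).
Hypothesis op_action : is_action op.
Variable F : I -> R.

(** The formal difference g F - F. *)
Definition coboundary (g : L) : I -> R := fun i => F (op g^-1 i) - F i.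

Lemma opK g : cancel (op g) (op g^-1%g).
Proof. by case: op_action => op1 opM i; rewrite -opM mulVg op1. Qed.

Lemma opVK g : cancel (op g^-1%g) (op g).
Proof. by case: op_action => op1 opM i; rewrite -opM mulgV op1. Qed.

Lemma sq_bounded_comp M (f : I -> R) (s : I -> I) :
  injective s -> sq_bounded M f -> sq_bounded M (f \o s).
Proof.
move=> s_inj fM J; apply: le_trans (fM [fset s i | i in J]%fset).
by rewrite /psum big_imfset //= => i j _ _; exact: s_inj.
Qed.

Lemma coboundary1 : coboundary 1%g = 0.
Proof.
by case: op_action => op1 _; apply/funext => i; rewrite /coboundary invg1 op1 subrr.
Qed.

(** The cocycle identity.  With its consequences, square summability of the
    coboundaries has to be checked on generators only. *)
Lemma coboundaryM g h :
  coboundary (g * h)%g = (coboundary h \o op g^-1%g) + coboundary g.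
Proof.
case: op_action => _ opM; apply/funext => i.
by rewrite fctE /coboundary /= invgM opM addrA subrK.
Qed.

Lemma l2_coboundaryM g h : coboundary g \in @l2_pred R I ->
  coboundary h \in @l2_pred R I -> coboundary (g * h)%g \in @l2_pred R I.
Proof.
move=> cg /asboolP[M ch]; rewrite coboundaryM; apply: rpredD => //.
by apply/asboolP; exists M; apply: sq_bounded_comp ch; exact: can_inj (opVK g).
Qed.

Lemma l2_coboundaryV g :
  coboundary g \in @l2_pred R I -> coboundary g^-1%g \in @l2_pred R I.
Proof.
move=> /asboolP[M cg].
have -> : coboundary g^-1%g = - (coboundary g \o op g).
  by apply/funext => i; rewrite fctE /coboundary /= invgK opK opprB.
rewrite rpredN; apply/asboolP; exists M.
by apply: sq_bounded_comp cg; exact: can_inj (opK g).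
Qed.

Hypothesis l2_coboundary : forall g, coboundary g \in @l2_pred R I.

Fact l2_transl_subproof g (u : l2 R I) : l2val u \o op g^-1%g \in @l2_pred R I.
Proof.
have [M uM] := l2P u; apply/asboolP; exists M; apply: sq_bounded_comp uM.
exact: can_inj (opVK g).
Qed.

Definition l2_transl g u : l2 R I := L2 (l2_transl_subproof g u).

(** The action by translation on F + l2, with origin moved to F. *)
Definition l2_act g u : l2 R I := l2_transl g u + L2 (l2_coboundary g).

Lemma l2_actE g (u : l2 R I) i : l2_act g u i = u (op g^-1%g i) + coboundary g i.
Proof. by []. Qed.

Lemma l2_act_action : is_action l2_act.
Proof.
case: (op_action) => op1 opM; split=> [u|g h u]; apply/val_inj/funext => i /=.
  by rewrite [LHS]l2_actE coboundary1 invg1 op1 addr0.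
by rewrite /= coboundaryM !fctE /= invgM opM addrA.
Qed.

Lemma l2_act_affine g : affine (l2_act g).
Proof.
move=> a u v; apply/val_inj/funext => i /=.
rewrite !fctE /=; rewrite /GRing.scale /= /GRing.scale /=; ring.
Qed.

Lemma l2_act_isometric g : isometric (l2_act g).
Proof.
have short h u v : `|l2_act h u - l2_act h v| <= `|u - v|.
  apply: norm_l2_le => //.
  have -> : l2val (l2_act h u - l2_act h v) = l2val (u - v) \o op h^-1%g.
    by apply/funext => i; rewrite /= !fctE /=; ring.
  by apply: sq_bounded_comp (sq_bounded_norm _); exact: can_inj (opVK h).
case: l2_act_action => act1 actM u v; apply/eqP; rewrite eq_le short /=.
have := short g^-1%g (l2_act g u) (l2_act g v).
by rewrite -!actM mulVg !act1.
Qed.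

(** The translate of v has the same norm as v, hence the coboundary of g is
    bounded in terms of v and of the image of v under g. *)
Theorem a_T_menable_of_coboundary :
    (forall M, finite_set [set g | sq_bounded M (coboundary g)]) ->
  a_T_menable R L.
Proof.
move=> fin; exists (l2 R I), (@l2dot R I : {dot l2 R I for idfun}), l2_act.
split; [exact: l2_hilbert|exact: l2_act_action| |].
  by move=> g; split; [exact: l2_act_affine|exact: l2_act_isometric].
move=> v r r0; apply: sub_finite_set (fin (2 * r ^+ 2 + 2 * `|v| ^+ 2)).
move=> g /= gv.
have -> : coboundary g = l2val (l2_act g v) + l2val (- l2_transl g v).
  by apply/funext => i; rewrite /= !fctE /=; ring.
apply: sq_boundedD => J.
  apply: le_trans (sq_bounded_norm _ J) _.
  by rewrite ler_pXn2r ?nnegrE // ltW.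
apply: le_trans (sq_bounded_norm _ J) _; rewrite normrN.
rewrite ler_pXn2r ?nnegrE //; apply: norm_l2_le => //.
by apply: sq_bounded_comp (sq_bounded_norm _); exact: can_inj (opVK g).
Qed.

End AffineAction.

(** * Actions of presented groups and of BS p q *)

Section PresentedAction.
Variables (T : choiceType) (rels : word T -> word T -> Prop) (X : Type).
Variable letter : T -> bool -> X -> X.
Hypothesis letterK : forall a b, cancel (letter a (~~ b)) (letter a b).

Definition word_op (w : word T) (x : X) : X :=
  foldr (fun l y => letter l.1 l.2 y) x w.

Hypothesis word_op_rel : forall u v, rels u v -> word_op u =1 word_op v.

Lemma word_op_cat u v x : word_op (u ++ v) x = word_op u (word_op v x).
Proof. exact: foldr_cat. Qed.

(** Operators for the letters which are mutually inverse and satisfy the relations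
    define an action of the presented group. *)
Lemma word_op_eq u v : pres_eq rels u v -> word_op u =1 word_op v.
Proof.
elim=> {u v}.
- by [].
- by move=> u v _ uv x.
- by move=> u v w _ uv _ vw x; rewrite uv.
- by move=> u v u' v' _ uv _ uv' x; rewrite !word_op_cat uv' uv.
- by move=> a b x /=; exact: letterK.
- exact: word_op_rel.
Qed.

Definition pres_op (g : presented rels) (x : X) : X := word_op (repr g) x.

Lemma pres_op_pi u x : pres_op (\pi_(presented rels) u) x = word_op u x.
Proof. exact/word_op_eq/repr_presented. Qed.

Lemma pres_op_action : is_action pres_op.
Proof.
split=> [x|]; first exact: (pres_op_pi [::]).
elim/quotW=> u; elim/quotW=> v x.
have -> : (\pi_(presented rels) u * \pi_(presented rels) v)%g =
    \pi_(presented rels) (u ++ v) by exact: presented_mulE.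
by rewrite !pres_op_pi word_op_cat.
Qed.

End PresentedAction.

Lemma presented_ind (T : choiceType) (rels : word T -> word T -> Prop)
    (P : presented rels -> Prop) :
  P 1%g ->
  (forall a g, P g -> P (\pi_(presented rels) [:: (a, true)] * g)%g) ->
  (forall a g, P g -> P ((\pi_(presented rels) [:: (a, true)])^-1 * g)%g) ->
  forall g, P g.
Proof.
move=> P1 Pp Pm; elim/quotW; elim=> [|[a b] u IHu]; first exact: P1.
have -> : \pi_(presented rels) ((a, b) :: u) =
    (\pi_(presented rels) [:: (a, b)] * \pi_(presented rels) u)%g.
  by rewrite [RHS](presented_mulE rels [:: (a, b)] u).
case: b; first exact: Pp.
have -> : \pi_(presented rels) [:: (a, false)] =
    ((\pi_(presented rels) [:: (a, true)])^-1)%g.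
  by rewrite [RHS](presented_invE rels [:: (a, true)]).
exact: Pm.
Qed.

Section BaumslagSolitarGenerators.
Variables p q : int.
Local Open Scope group_scope.

Definition gx : BS p q := \pi_(presented (BS_rel p q)) wx.
Definition gt : BS p q := \pi_(presented (BS_rel p q)) wt.

(** Powers of x with exponent in int. *)
Definition gX (n : int) : BS p q :=
  match n with Posz k => gx ^+ k | Negz k => gx ^- k.+1 end.

Lemma gXS n : gX (n + 1)%R = gx * gX n.
Proof.
case: n => [n|[|n]].
- have -> : (n%:Z + 1 = n.+1%:Z)%R by lia.
  by rewrite /= expgS.
- by rewrite /= expg1 mulgV.
- have -> : (Negz n.+1 + 1)%R = Negz n by rewrite !NegzE; lia.
  by rewrite /= [gx ^+ n.+2]expgSr invgM mulgA mulgV mul1g.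
Qed.

Lemma gXD m n : gX (m + n)%R = gX m * gX n.
Proof.
have gXP k : gX (k - 1)%R = gx^-1 * gX k.
  by have := gXS (k - 1)%R; rewrite subrK => ->; rewrite mulgA mulVg mul1g.
elim/int_rect: m => [|k IH|k IH].
- by rewrite add0r mul1g.
- have -> : (k.+1%:Z + n = k%:Z + n + 1)%R by lia.
  have -> : (k.+1%:Z = k%:Z + 1)%R by lia.
  by rewrite !gXS IH mulgA.
- have -> : (- k.+1%:Z + n = - k%:Z + n - 1)%R by lia.
  have -> : (- k.+1%:Z = - k%:Z - 1)%R by lia.
  by rewrite !gXP IH mulgA.
Qed.

Lemma gX0 : gX 0 = 1. Proof. by []. Qed.

Lemma gXN n : gX (- n)%R = (gX n)^-1.
Proof. by apply: (@mulgI _ (gX n)); rewrite -gXD subrr mulgV. Qed.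

Lemma pi_expwx n : \pi_(presented (BS_rel p q)) (expw wx n) = gX n.
Proof.
have E k : \pi_(presented (BS_rel p q)) (flatten (nseq k wx)) = gx ^+ k.
  elim: k => [|k IHk] //=.
  rewrite expgS -IHk; exact/esym/(presented_mulE _ wx).
case: n => n; first exact: E.
have flat (l : bool * bool) k : flatten (nseq k [:: l]) = nseq k l.
  by elim: k => //= k ->.
have -> : expw wx (Negz n) = invw (flatten (nseq n.+1 wx)).
  rewrite /expw (flat (true, false)) (flat (true, true)) /invw map_nseq.
  by rewrite rev_nseq.
rewrite [RHS]/gX -E; exact/esym/presented_invE.
Qed.

(** The relation x^p t = t x^q raised to the n-th power. *)
Lemma BS_relation n : gX (n * p)%R * gt = gt * gX (n * q)%R.
Proof.
have E : gX p = gt * gX q * gt^-1.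
  rewrite -!pi_expwx.
  have -> : \pi_(presented (BS_rel p q)) (expw wx p) =
      \pi_(presented (BS_rel p q)) (wt ++ expw wx q ++ invw wt).
    by apply/presentedP/asboolP/pres_rel.
  rewrite catA -!presented_mulE -presented_invE.
  by [].
elim/int_rect: n => [|n IH|n IH]; first by rewrite !mul0r mul1g mulg1.
- have e : (n.+1%:Z = n%:Z + 1)%R by lia.
  by rewrite e !mulrDl !mul1r !gXD -mulgA E mulgVK mulgA IH mulgA.
- have e : (- n.+1%:Z = - n%:Z - 1)%R by lia.
  rewrite e !mulrDl !mulN1r !gXD -mulgA !(gXN p) !(gXN q) E !invgM invgK.
  by rewrite !mulgA mulgVK IH.
Qed.

End BaumslagSolitarGenerators.

Arguments gX : simpl never.

Section BaumslagSolitarAction.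
Variables (p q : int) (X : Type) (fx : int -> X -> X) (ft : bool -> X -> X).
Hypothesis fx0 : fx 0 =1 id.
Hypothesis fxD : forall m n, fx (m + n) =1 fx m \o fx n.
Hypothesis ftK : forall b, cancel (ft (~~ b)) (ft b).
Hypothesis f_rel : forall x, ft true (fx q (ft false x)) = fx p x.

(** An action of BS p q is given by a one-parameter group fx of powers of x and by
    mutually inverse maps ft true, ft false for t and its inverse. *)
Definition bs_letter (a b : bool) : X -> X :=
  if a then fx (if b then 1 else -1) else ft b.

Fact bs_letterK a b : cancel (bs_letter a (~~ b)) (bs_letter a b).
Proof.
case: a => x /=; last exact: ftK.
have := fxD (if b then 1 else -1) (if ~~ b then 1 else -1) x.
by case: b => /= <-; rewrite ?subrr ?addNr fx0.
Qed.

Lemma word_op_wx n : word_op bs_letter (expw wx n) =1 fx n.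
Proof.
have flat b k x : word_op bs_letter (flatten (nseq k [:: (true, b)])) x =
    fx (if b then k%:Z else - k%:Z) x.
  elim: k => [|k IHk] /=; first by rewrite oppr0 if_same fx0.
  rewrite IHk /bs_letter /=.
  have := fxD (if b then 1 else -1) (if b then k%:Z else - k%:Z) x.
  move=> /= <-; congr (fx _ x); case: b {IHk}; lia.
case: n => n x; first exact: flat.
by rewrite /expw (flat false) NegzE.
Qed.

Fact bs_word_op_rel u v : BS_rel p q u v -> word_op bs_letter u =1 word_op bs_letter v.
Proof. by move=> [-> ->] x; rewrite !word_op_cat !word_op_wx /= f_rel. Qed.

Definition bs_op (g : BS p q) (x : X) : X := pres_op bs_letter g x.

Lemma bs_op_action : is_action bs_op.
Proof. exact: (pres_op_action bs_letterK bs_word_op_rel). Qed.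

Lemma bs_op_gX n : bs_op (gX p q n) =1 fx n.
Proof.
move=> x; rewrite -pi_expwx /bs_op (pres_op_pi bs_letterK bs_word_op_rel).
exact: word_op_wx.
Qed.

Lemma bs_op_gt : bs_op (gt p q) =1 ft true.
Proof. by move=> x; rewrite /bs_op (pres_op_pi bs_letterK bs_word_op_rel). Qed.

Lemma bs_op_gtV : bs_op (gt p q)^-1%g =1 ft false.
Proof.
have -> : ((gt p q)^-1)%g = \pi_(presented (BS_rel p q)) (invw wt).
  exact: presented_invE.
by move=> x; rewrite /bs_op (pres_op_pi bs_letterK bs_word_op_rel).
Qed.

Lemma BS_ind (P : BS p q -> Prop) :
  P 1%g ->
  (forall n g, P g -> P (gX p q n * g)%g) ->
  (forall g, P g -> P (gt p q * g)%g) ->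
  (forall g, P g -> P ((gt p q)^-1 * g)%g) ->
  forall g, P g.
Proof.
move=> P1 Px Pt PtV; apply: (@presented_ind _ (BS_rel p q)) => // [] [] g Pg.
- exact: (Px 1).
- exact: Pt.
- by have := Px (-1) g Pg; rewrite gXN.
- exact: PtV.
Qed.

End BaumslagSolitarAction.

(** * The Bass-Serre tree *)

Section BassSerreTree.
Variables (p q : int).
Hypotheses (hp : p != 0) (hq : q != 0).

(** The vertices of the tree are the cosets g <x>.  A list (i1, e1) :: (i2, e2) ...
    stands for the coset of x^i1 t^e1 x^i2 t^e2 ..., where t^true is t and t^false
    is its inverse.  As x^p t = t x^q, the digit before t^true matters modulo p
    only, and the digit before t^false modulo q only. *)
Definition modulus (e : bool) : int := if e then p else q.

Definition starts (e : bool) (l : seq (int * bool)) : bool :=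
  if l is a :: _ then a == (0, e) else false.

(** Normal forms: digits are remainders, and no t^e is followed by x^0 t^(~~ e). *)
Fixpoint reduced (l : seq (int * bool)) : bool :=
  if l is (i, e) :: l' then
    [&& (i %% modulus e)%Z == i, ~~ starts (~~ e) l' & reduced l']
  else true.

(** Multiplication by x^m on the left, as an odometer: when a digit overflows, the
    carry c * modulus e moves through t^e and becomes c * modulus (~~ e). *)
Fixpoint list_x (m : int) (l : seq (int * bool)) : seq (int * bool) :=
  if l is (i, e) :: l' then
    (((i + m) %% modulus e)%Z, e) ::
      list_x (((i + m) %/ modulus e)%Z * modulus (~~ e)) l'
  else [::].

(** Multiplication by t^e on the left, followed by a cancellation if necessary. *)
Definition list_t (e : bool) (l : seq (int * bool)) : seq (int * bool) :=
  if starts (~~ e) l then behead l else (0, e) :: l.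

Lemma modulus_neq0 e : modulus e != 0. Proof. by case: e. Qed.

(** The carry through t^e is a multiple of modulus (~~ e).  It does not change a
    following digit before t^(~~ e), so it neither creates nor destroys a
    cancellation. *)
Lemma starts_list_x e c l : reduced l -> starts e (list_x (c * modulus e) l) = starts e l.
Proof.
case: l => [|[i e'] l] //= /and3P[/eqP ie _ _].
rewrite !xpair_eqE; case: (e' =P e) => [ee'|_]; last by rewrite !andbF.
by rewrite ee' in ie *; rewrite addrC modzMDl ie.
Qed.

Lemma reduced_list_x m l : reduced l -> reduced (list_x m l).
Proof.
elim: l m => [|[i e] l IHl] m //= /and3P[_ sl rl].
by rewrite modz_mod eqxx starts_list_x // sl IHl.
Qed.

Lemma list_xD m n l : list_x (m + n) l = list_x m (list_x n l).
Proof.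
elim: l m n => [|[i e] l IHl] m n //=; congr ((_, _) :: _).
  by rewrite modzDml (addrC m) addrA.
rewrite -IHl -mulrDl; congr (list_x (_ * _) _).
rewrite [RHS]addrC -divzMDl ?modulus_neq0 //.
by rewrite [in RHS]addrA -divz_eq -!addrA (addrC n).
Qed.

Lemma list_x0 l : reduced l -> list_x 0 l = l.
Proof.
elim: l => [|[i e] l IHl] //= /and3P[/eqP ie _ rl]; rewrite addr0 ie.
suff -> : (i %/ modulus e)%Z = 0 by rewrite mul0r IHl.
have /eqP : (i %/ modulus e)%Z * modulus e = 0.
  by apply: (addIr i); rewrite add0r [RHS](divz_eq i (modulus e)) ie.
by rewrite mulf_eq0 (negbTE (modulus_neq0 e)) orbF => /eqP.
Qed.

Lemma list_x_inj m : {in reduced &, injective (list_x m)}.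
Proof.
by move=> l l' rl rl' E; rewrite -(list_x0 rl) -(list_x0 rl') -(addNr m) !list_xD E.
Qed.

Lemma size_list_x m l : size (list_x m l) = size l.
Proof. by elim: l m => [|[i e] l IHl] m //=; rewrite IHl. Qed.

Lemma take_list_x m k l : take k (list_x m l) = list_x m (take k l).
Proof. by elim: l m k => [|[i e] l IHl] m [|k] //=; rewrite IHl. Qed.

Lemma reduced_take k l : reduced l -> reduced (take k l).
Proof.
elim: l k => [|[i e] l IHl] [|k] //= /and3P[-> sl rl] /=.
by rewrite IHl // andbT; case: l k sl {IHl rl} => [|a l] [|k].
Qed.

Lemma reduced_list_t e l : reduced l -> reduced (list_t e l).
Proof.
rewrite /list_t; case: ifP => [|sl rl] /=; last by rewrite mod0z eqxx sl.
by case: l => [|[i e'] l] //= _ /and3P[].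
Qed.

Lemma list_tK e l : reduced l -> list_t e (list_t (~~ e) l) = l.
Proof.
rewrite /list_t negbK; case: l => [|[i e'] l] /=; first by rewrite eqxx.
case: ((i, e') =P (0, e)) => [[-> ->] /and3P[_ /negbTE -> _]|_ _] //=.
by rewrite eqxx.
Qed.

(** On normal forms the operators satisfy the defining relation, so that BS p q
    acts on normal forms (van der Waerden's argument). *)
Lemma list_relation l :
  reduced l -> list_t true (list_x q (list_t false l)) = list_x p l.
Proof.
have := @starts_list_x true 1; rewrite mul1r /= => sx rl.
rewrite {2}/list_t /=; case: ifPn => sl.
  case: l rl sl => [|[i e] l] //= /and3P[_ sl rl] /eqP[i0 e0]; subst i e.
  have := @starts_list_x false 1 l rl; rewrite mul1r /= => sx'.
  rewrite /list_t /= sx' (negbTE sl) /= add0r modzz divzz hp mul1r.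
  by [].
by rewrite /list_t /= add0r modzz divzz hq mul1r eqxx.
Qed.

Definition parent (u w : seq (int * bool)) : bool :=
  (size w == (size u).+1) && (take (size u) w == u).

Lemma parent_list_x m u w : reduced u -> reduced w ->
  parent (list_x m u) (list_x m w) = parent u w.
Proof.
move=> ru rw; rewrite /parent !size_list_x take_list_x; congr (_ && _).
apply/eqP/eqP => [E|->] //; apply: list_x_inj E => //; exact: reduced_take.
Qed.

(** The only edge whose orientation from the base vertex is changed by t^e. *)
Definition base_edge (e : bool) (u w : seq (int * bool)) : bool :=
  (u == [::]) && (w == [:: (0, ~~ e)]).

(** Away from base_edge, t^e adds a first letter to both ends of an edge or
    removes one from both. *)
Lemma parent_list_t e u w : reduced u -> reduced w ->
    ~~ base_edge e u w -> ~~ base_edge e w u ->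
  parent (list_t e u) (list_t e w) = parent u w.
Proof.
rewrite /parent /list_t /base_edge.
case: ifPn => sw; case: ifPn => su //=.
- case: u su => [|a u] // /eqP -> /=; case: w sw => [|b w] //= /eqP -> /=.
  by rewrite eqSS eqseq_cons eqxx.
- case: w sw => [|a w] //= /eqP -> /= ru /and3P[_ nsw _] nb _.
  have -> : (take (size u) ((0, ~~ e) :: w) == u) = (u == [::]).
    case: u su {ru nb} => [|c u] //=; rewrite eqseq_cons eq_sym.
    by move=> /negbTE ->.
  have -> : (take (size u).+1 w == (0, e) :: u) = false.
    case: w nsw {nb} => [|c w] //=; rewrite eqseq_cons negbK.
    by move=> /negbTE ->.
  rewrite andbF; case: (u =P [::]) nb => [-> /=|]; last by rewrite andbF.
  by rewrite eqseq_cons eqxx /= andbT eqSS size_eq0 => /negbTE.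
- case: u su => [|a u] //= /eqP -> /= /and3P[_ nsu _] rw _.
  move=> nb; rewrite !eqSS; case: (u =P [::]) => [u0|].
    move: nb; rewrite u0 /= eqseq_cons !eqxx andbT /=.
    case: w sw {rw} => [|b w] //=; rewrite eqseq_cons.
    by move=> /negbTE ->; rewrite andbF.
  case: u nsu {nb} => [|c u] //= nsu _.
  rewrite eqseq_cons [_ == c]eq_sym; rewrite negbK in nsu.
  rewrite (negbTE nsu) /= andbF.
  case: w sw {rw} => [|b w] //=; rewrite eqseq_cons.
  by move=> /negbTE ->; rewrite andbF.
- by rewrite eqSS eqseq_cons eqxx.
Qed.

Definition vertex := {l : seq (int * bool) | reduced l}.

Definition vertex_x m (v : vertex) : vertex :=
  exist _ (list_x m (val v)) (reduced_list_x m (valP v)).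
Definition vertex_t e (v : vertex) : vertex :=
  exist _ (list_t e (val v)) (reduced_list_t e (valP v)).

Fact vertex_x0 : vertex_x 0 =1 id.
Proof. by move=> v; apply/val_inj/list_x0/valP. Qed.

Fact vertex_xD m n : vertex_x (m + n) =1 vertex_x m \o vertex_x n.
Proof. by move=> v; apply/val_inj/list_xD. Qed.

Fact vertex_tK e : cancel (vertex_t (~~ e)) (vertex_t e).
Proof. by move=> v; apply/val_inj/list_tK/valP. Qed.

Fact vertex_rel v : vertex_t true (vertex_x q (vertex_t false v)) = vertex_x p v.
Proof. exact/val_inj/list_relation/valP. Qed.

Definition vertex_op : BS p q -> vertex -> vertex := bs_op vertex_x vertex_t.

Lemma vertex_op_action : is_action vertex_op.
Proof. exact: (bs_op_action vertex_x0 vertex_xD vertex_tK vertex_rel). Qed.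

Lemma vertex_op_gX n v : vertex_op (gX p q n) v = vertex_x n v.
Proof. exact: (bs_op_gX vertex_x0 vertex_xD vertex_tK vertex_rel). Qed.

Lemma vertex_op_gt v : vertex_op (gt p q) v = vertex_t true v.
Proof. exact: (bs_op_gt vertex_x0 vertex_xD vertex_tK vertex_rel). Qed.

Lemma vertex_op_gtV v : vertex_op (gt p q)^-1%g v = vertex_t false v.
Proof. exact: (bs_op_gtV vertex_x0 vertex_xD vertex_tK vertex_rel). Qed.

Definition base_vertex : vertex := exist _ [::] isT.

Definition vparent (u w : vertex) : bool := parent (val u) (val w).
Definition adjacent (u w : vertex) : bool := vparent u w || vparent w u.

Lemma vparent_x m u w : vparent (vertex_x m u) (vertex_x m w) = vparent u w.
Proof. by apply: parent_list_x; exact: valP. Qed.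

Lemma adjacent_t e u w : adjacent u w -> adjacent (vertex_t e u) (vertex_t e w).
Proof.
have base x y : base_edge e x y -> parent (list_t e y) (list_t e x).
  by move=> /andP[/eqP -> /eqP ->]; rewrite /parent /list_t /= eqxx.
rewrite /adjacent /vparent /=.
have [/base -> _|b1] := boolP (base_edge e (val u) (val w)).
  by rewrite orbT.
have [/base -> _ //|b2] := boolP (base_edge e (val w) (val u)).
by rewrite !parent_list_t //; exact: valP.
Qed.

Lemma adjacent_op g u w :
  adjacent u w -> adjacent (vertex_op g u) (vertex_op g w).
Proof.
have [op1 opM] := vertex_op_action.
elim/BS_ind: g => [|n g IH|g IH|g IH]; first by rewrite !op1.
- by move=> /IH; rewrite !opM !vertex_op_gX /adjacent !vparent_x.
- by move=> /IH; rewrite !opM !vertex_op_gt; exact: adjacent_t.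
- by move=> /IH; rewrite !opM !vertex_op_gtV; exact: adjacent_t.
Qed.

Lemma vertex_op_inj g : injective (vertex_op g).
Proof.
have [op1 opM] := vertex_op_action.
by apply: (can_inj (g := vertex_op g^-1%g)) => v; rewrite -opM mulVg op1.
Qed.

Lemma vparent_uniq u u' w : vparent u w -> vparent u' w -> u = u'.
Proof.
move=> /andP[/eqP su /eqP uE] /andP[/eqP su' /eqP uE'].
by apply: val_inj; rewrite -uE -uE'; move: su'; rewrite su => -[->].
Qed.

Lemma vparent_asym u w : vparent u w -> ~~ vparent w u.
Proof. by move=> /andP[/eqP su _]; rewrite /vparent /parent su ltn_eqF // ltnS leqW. Qed.

Definition ancestor (v : vertex) k : vertex :=
  exist _ (take k (val v)) (reduced_take k (valP v)).

Lemma vparent_ancestor v k :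
  (k < size (val v))%N -> vparent (ancestor v k) (ancestor v k.+1).
Proof.
move=> kv.
by rewrite /vparent /parent /= !size_takel ?(ltnW kv) // take_takel // !eqxx.
Qed.

(** The translate by g^-1 of the path from g v0 to v0 starts at v0 and does not
    backtrack, as each vertex has a unique parent.  It thus leads away from v0 at
    each step, so that g^-1 reverses the orientation of all edges of the path. *)
Lemma vparent_geodesic g k : (k < size (val (vertex_op g base_vertex)))%N ->
  vparent (vertex_op g^-1%g (ancestor (vertex_op g base_vertex) k.+1))
          (vertex_op g^-1%g (ancestor (vertex_op g base_vertex) k)).
Proof.
have [op1 opM] := vertex_op_action.
set v := vertex_op g base_vertex; set h := vertex_op g^-1%g.
have adj j : (j < size (val v))%N ->
    vparent (h (ancestor v j.+1)) (h (ancestor v j)) \/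
    vparent (h (ancestor v j)) (h (ancestor v j.+1)).
  move=> /vparent_ancestor jv; apply/orP; rewrite orbC; apply: adjacent_op.
  by rewrite /adjacent jv.
move: {2}(size (val v) - k.+1)%N (erefl (size (val v) - k.+1)%N) => d.
elim: d k => [|d IHd] k kd kv.
  case: (adj k kv) => //.
  have -> : ancestor v k.+1 = v.
    by apply: val_inj; apply: take_oversize; rewrite -subn_eq0 kd.
  have -> : h v = base_vertex by rewrite /h /v -opM mulVg op1.
  by rewrite /vparent /parent.
case: (adj k kv) => // up.
have k1v : (k.+1 < size (val v))%N by lia.
have kd1 : (size (val v) - k.+2)%N = d by lia.
have := IHd k.+1 kd1 k1v.
move=> /(vparent_uniq up)/vertex_op_inj/(congr1 (fun w => size (val w))) /=.
by rewrite !size_takel ?(ltnW kv) //; lia.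
Qed.

Definition t_pow (e : bool) : BS p q := if e then gt p q else (gt p q)^-1%g.

(** The group element spelled by a list. *)
Definition section_word (l : seq (int * bool)) : BS p q :=
  foldr (fun a g => gX p q a.1 * t_pow a.2 * g)%g 1%g l.

Lemma t_pow_gX e c :
  (t_pow e * gX p q (c * modulus (~~ e)) = gX p q (c * modulus e) * t_pow e)%g.
Proof.
case: e => /=; first by rewrite BS_relation.
by apply: (@mulgI _ (gt p q)); rewrite mulVKg !mulgA -BS_relation mulgK.
Qed.

Lemma section_word_list_x m l : exists k,
  section_word (list_x m l) = (gX p q m * section_word l * gX p q k)%g.
Proof.
elim: l m => [|[i e] l IHl] m /=.
  by exists (- m); rewrite mulg1 gXN mulgV.
have [k ->] := IHl (((i + m) %/ modulus e)%Z * modulus (~~ e)).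
exists k; rewrite !mulgA -[(_ * t_pow e * _)%g]mulgA t_pow_gX.
rewrite !mulgA -gXD [X in gX p q X](_ : _ = m + i); last first.
  by rewrite addrC -divz_eq addrC.
by rewrite gXD.
Qed.

Lemma section_word_list_t e l : section_word (list_t e l) = (t_pow e * section_word l)%g.
Proof.
rewrite /list_t; case: ifP => [|_] /=; last by rewrite gX0 mul1g.
case: l => [|[i e'] l] //= /eqP[-> ->]; rewrite gX0 mul1g mulgA.
by case: e; rewrite /= ?mulgV ?mulVg mul1g.
Qed.

(** Equivariance of section_word modulo <x> on the right. *)
Lemma section_word_op g v : exists k,
  section_word (val (vertex_op g v)) = (g * section_word (val v) * gX p q k)%g.
Proof.
have [op1 opM] := vertex_op_action.
elim/BS_ind: g => [|n g [k IH]|g [k IH]|g [k IH]].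
- by exists 0; rewrite op1 mul1g gX0 mulg1.
- rewrite opM vertex_op_gX /=.
  have [k' ->] := section_word_list_x n (val (vertex_op g v)).
  by exists (k + k'); rewrite IH gXD !mulgA.
- by exists k; rewrite opM vertex_op_gt /= section_word_list_t IH !mulgA.
- by exists k; rewrite opM vertex_op_gtV /= section_word_list_t IH !mulgA.
Qed.

(** The stabilizer of the base vertex is <x>. *)
Lemma coset_of_vertex g :
  exists k, g = (section_word (val (vertex_op g base_vertex)) * gX p q k)%g.
Proof.
have [k ->] := section_word_op g base_vertex.
by exists (- k); rewrite mulg1 gXN mulgK.
Qed.

(** Normal forms have bounded digits. *)
Lemma finite_ball n : finite_set [set v : vertex | (size (val v) <= n)%N].
Proof.
pose dig : set (int * bool) :=
  [set (i%:Z, e) | i in `I_(`|p| + `|q|) & e in [set: bool]].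
have fdig : finite_set dig.
  by apply: finite_image2; [exact: finite_II|exact: finite_finset].
pose B n : set (seq (int * bool)) := [set l | reduced l /\ (size l <= n)%N].
have fB : finite_set (B n).
  elim: n => [|n IHn].
    by apply: sub_finite_set (finite_set1 [::]) => l [_]; case: l.
  have fin : finite_set ([set [::]] `|` [set a :: l | a in dig & l in B n]).
    by rewrite finite_setU; split; [exact: finite_set1|exact: finite_image2].
  apply: sub_finite_set fin => -[|[i e] l] [/= rl sl]; [by left|right].
  case/and3P: rl => /eqP ie _ rl; exists (i, e); last by exists l.
  have i0 : 0 <= i by rewrite -ie modz_ge0 ?modulus_neq0.
  have il : i < `|modulus e| by rewrite -ie ltz_mod ?modulus_neq0.
  exists `|i|%N; last by exists e => //; rewrite gez0_abs.
  by case: e il {ie sl} => /= il; lia.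
have inj : {in (val @^-1` B n : set vertex) &, injective (val : vertex -> _)}.
  by move=> u w _ _; exact: val_inj.
apply: sub_finite_set (finite_preimage inj fB) => v /= vn.
by split=> //; exact: valP.
Qed.

End BassSerreTree.

(** * Folner sets in the affine group *)

Section FolnerLayers.
Variables (p q : int).
Hypotheses (hp : p != 0) (hq : q != 0).

Local Notation affpt := (int * rat)%type.

(** The affine map y |-> r^n y + b with r = p / q is encoded by the pair
    (n, r^-n b); composing with x and t on the left gives aff_x 1 and aff_t true.
    In these coordinates t does not change the second component, and ratio is r^-1. *)
Definition ratio : rat := q%:Q / p%:Q.

Definition aff_x (k : int) (y : affpt) : affpt := (y.1, y.2 + k%:Q * ratio ^ y.1).
Definition aff_t (e : bool) (y : affpt) : affpt := (y.1 + (if e then 1 else -1), y.2).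

Let p0 : p%:Q != 0. Proof. by rewrite intr_eq0. Qed.
Let q0 : q%:Q != 0. Proof. by rewrite intr_eq0. Qed.

Fact ratio_neq0 : ratio != 0. Proof. by rewrite mulf_neq0 ?invr_eq0. Qed.

Fact aff_x0 : aff_x 0 =1 id.
Proof. by case=> n c; rewrite /aff_x mul0r addr0. Qed.

Fact aff_xD m n : aff_x (m + n) =1 aff_x m \o aff_x n.
Proof. by case=> i c; rewrite /aff_x /= rmorphD mulrDl addrA addrAC. Qed.

Fact aff_tK e : cancel (aff_t (~~ e)) (aff_t e).
Proof. by case=> n c; rewrite /aff_t /=; case: e; rewrite ?subrK ?addrK. Qed.

Fact aff_rel y : aff_t true (aff_x q (aff_t false y)) = aff_x p y.
Proof.
case: y => n c; rewrite /aff_t /aff_x /= subrK expfzDr ?ratio_neq0 //.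
rewrite exprN1 /ratio; congr (_, _ + _).
by field; rewrite p0 q0.
Qed.

Definition aff_op : BS p q -> affpt -> affpt := bs_op aff_x aff_t.

Lemma aff_op_action : is_action aff_op.
Proof. exact: (bs_op_action aff_x0 aff_xD aff_tK aff_rel). Qed.

Lemma aff_op_gX n y : aff_op (gX p q n) y = aff_x n y.
Proof. exact: (bs_op_gX aff_x0 aff_xD aff_tK aff_rel). Qed.

Lemma aff_op_gtV y : aff_op (gt p q)^-1%g y = aff_t false y.
Proof. exact: (bs_op_gtV aff_x0 aff_xD aff_tK aff_rel). Qed.

(** The m-th Folner set is the rectangle 0 <= n < height m, 0 <= z < width m of the
    grid of the points (n, z / p^height).  On row i, x acts as a translation of z
    by the integer grid_step m i, which step_bound bounds on all rows.  So t moves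
    a proportion O(1 / height) of the rectangle, and x a proportion
    O(step_bound / width). *)
Definition height (m : nat) : nat := 4 ^ m.
Definition step_bound (m : nat) : nat := (`|p| * `|q|) ^ height m.
Definition width (m : nat) : nat := 2 ^ m * (2 ^ m * step_bound m) ^ 2.

Definition grid (m i : nat) (z : int) : affpt :=
  (i%:Z, z%:Q / p%:Q ^+ height m).

Definition folner (m : nat) : seq affpt :=
  [seq grid m i j%:Z | i <- iota 0 (height m), j <- iota 0 (width m)].

Definition grid_step (m i : nat) : int := q ^+ i * p ^+ (height m - i).

Lemma step_bound_gt0 m : (0 < step_bound m)%N.
Proof. by rewrite expn_gt0 muln_gt0 !absz_gt0 hp hq. Qed.

Lemma grid_inj m i i' z z' : grid m i z = grid m i' z' -> i = i' /\ z = z'.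
Proof.
case=> -> E; split=> //; apply: (@intr_inj rat).
by apply: (mulIf _ E); rewrite invr_eq0 expf_neq0.
Qed.

Lemma grid_folner m i z :
  (grid m i z \in folner m) = (i < height m)%N && (0 <= z < (width m)%:Z).
Proof.
apply/allpairsP/idP => [[[i' j] /= []]|].
  by rewrite !mem_iota /= => iN jM /grid_inj[-> ->]; lia.
case: z => [j|j]; last by rewrite andbF.
by move=> /andP[iN jM]; exists (i, j); rewrite !mem_iota.
Qed.

Lemma folnerP m y : y \in folner m -> exists i z, y = grid m i z.
Proof. by case/allpairsP=> -[i j] /= [_ _ ->]; exists i, j%:Z. Qed.

Lemma uniq_folner m : uniq (folner m).
Proof.
apply: allpairs_uniq; rewrite ?iota_uniq // => -[i j] [i' j'] _ _ /=.
by case/grid_inj => -> [->].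
Qed.

Lemma size_folner m : size (folner m) = (height m * width m)%N.
Proof. by rewrite size_allpairs !size_iota. Qed.

Lemma aff_x_grid m i k z : (i < height m)%N ->
  aff_x k (grid m i z) = grid m i (z + k * grid_step m i).
Proof.
move=> /ltnW iN; rewrite /aff_x /grid /grid_step /=; congr (_, _).
have -> : p%:Q ^+ height m = p%:Q ^+ (height m - i) * p%:Q ^+ i.
  by rewrite -exprD subnK.
rewrite /ratio -exprnP expr_div_n !rmorphD /= !rmorphM /= !rmorphXn /=.
by field; rewrite !expf_neq0.
Qed.

Lemma grid_step_neq0 m i : grid_step m i != 0.
Proof. by rewrite mulf_neq0 ?expf_neq0. Qed.

Lemma grid_step_le m i : (i < height m)%N -> `|grid_step m i| <= (step_bound m)%:Z.
Proof.
move=> iN; rewrite -abszE lez_nat abszM !abszX.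
rewrite /step_bound expnMn mulnC leq_mul // leq_pexp2l ?absz_gt0 //; lia.
Qed.

(** All grid points at distance at most step_bound from the left or right side. *)
Definition folner_boundary_x (m : nat) : seq affpt :=
  [seq grid m i (a%:Z - (step_bound m)%:Z)
     | i <- iota 0 (height m), a <- iota 0 (2 * step_bound m)] ++
  [seq grid m i (a%:Z + (width m)%:Z - (step_bound m)%:Z)
     | i <- iota 0 (height m), a <- iota 0 (2 * step_bound m)].

(** The bottom row, and the row above the top one. *)
Definition folner_boundary_t (m : nat) : seq affpt :=
  [seq grid m i j%:Z | i <- [:: 0; height m], j <- iota 0 (width m)].

Lemma folner_xP m y :
  (aff_x (-1) y \in folner m) != (y \in folner m) -> y \in folner_boundary_x m.
Proof.
move=> neq.
have [i [z [iN yE]]] : exists i z, (i < height m)%N /\ y = grid m i z.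
  have [yA|yA] := boolP (y \in folner m).
    have [i [z yE]] := folnerP yA; exists i, z; split=> //.
    by move: yA; rewrite yE grid_folner => /andP[].
  move: neq; rewrite (negbTE yA); case: (boolP (_ \in _)) => // xA _.
  have [i [z xE]] := folnerP xA; exists i, (z + grid_step m i).
  have iN : (i < height m)%N by move: xA; rewrite xE grid_folner => /andP[].
  split=> //; rewrite -[y](_ : aff_x 1 (aff_x (-1) y) = y).
    by rewrite xE aff_x_grid // mul1r.
  by have /= <- := aff_xD 1 (-1) y; rewrite subrr aff_x0.
move: neq; rewrite yE aff_x_grid // !grid_folner iN /= => neq.
have := grid_step_le iN; rewrite ler_norml => /andP[s1 s2].
have inside a : (a < 2 * step_bound m)%N -> a \in iota 0 (2 * step_bound m).
  by rewrite mem_iota.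
rewrite mem_cat; apply/orP.
have [zlo|zhi] : (- (step_bound m)%:Z <= z < (step_bound m)%:Z) \/
   ((width m)%:Z - (step_bound m)%:Z <= z < (width m)%:Z + (step_bound m)%:Z).
- by move: neq; do 4?case: lerP => //=; lia.
- left; apply/allpairsP; exists (i, absz (z + (step_bound m)%:Z)) => /=.
  rewrite mem_iota; split=> //; first by apply: inside; lia.
  by congr (grid _ _ _); lia.
- right; apply/allpairsP.
  exists (i, absz (z - (width m)%:Z + (step_bound m)%:Z)) => /=.
  rewrite mem_iota; split=> //; first by apply: inside; lia.
  by congr (grid _ _ _); lia.
Qed.

Lemma folner_tP m y :
  (aff_t false y \in folner m) != (y \in folner m) -> y \in folner_boundary_t m.
Proof.
case: y => n c neq.
have [i [j [jM [-> -> iN]]]] : exists i j, (j < width m)%N /\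
    [/\ n = i%:Z, c = (grid m i j%:Z).2 & i = 0 \/ i = height m].
  have [] := boolP ((n, c) \in folner m) => yA.
    case/allpairsP: (yA) => -[i j] /= []; rewrite !mem_iota => iN jM [nE cE].
    exists i, j; split=> //; split=> //; left; apply/eqP; move: neq; rewrite yA.
    apply: contraR; rewrite -lt0n => i0; rewrite eqb_id.
    have -> : aff_t false (n, c) = grid m i.-1 j%:Z.
      by rewrite nE cE /aff_t /grid /=; congr (_, _); lia.
    by rewrite grid_folner; lia.
  move: neq; rewrite (negbTE yA); case: (boolP (_ \in _)) => // tA _.
  case/allpairsP: (tA) => -[i j] /= []; rewrite !mem_iota => iN jM [nE cE].
  exists i.+1, j; split=> //; split=> //; first by move: nE; lia.
  right; apply/eqP; move: yA; apply: contraR => iN'.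
  have -> : (n, c) = grid m i.+1 j%:Z.
    by rewrite /grid cE; congr (_, _); move: nE; lia.
  by rewrite grid_folner; lia.
rewrite /folner_boundary_t.
apply/allpairsP; exists (i, j); rewrite mem_iota; split=> //=.
by rewrite !inE; case: iN => ->; rewrite eqxx ?orbT.
Qed.

(** The translation of each row is by a nonzero multiple of k. *)
Lemma folner_displaced m k y : (width m <= `|k|)%N ->
  y \in folner m -> aff_x k y \notin folner m.
Proof.
move=> kM yA; have [i [z yE]] := folnerP yA; subst y; move: yA.
rewrite grid_folner => /andP[iN zM]; rewrite aff_x_grid // grid_folner iN /=.
have : (width m <= absz (k * grid_step m i)%R)%N.
  by rewrite abszM (leq_trans kM) // leq_pmulr // absz_gt0 grid_step_neq0.
by apply/contraTN; lia.
Qed.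

End FolnerLayers.

(** * Properness *)

Section BaumslagSolitarWalls.
Variables (R : realType) (p q : int).
Hypotheses (hp : p != 0) (hq : q != 0).

Local Notation vertex := (vertex p q).

(** Pairs of vertices of the tree, and a copy of the affine group for each m. *)
Definition site := ((vertex * vertex) + (nat * (int * rat)))%type.

Definition site_op (g : BS p q) (i : site) : site :=
  match i with
  | inl (u, w) => inl (vertex_op g u, vertex_op g w)
  | inr (m, y) => inr (m, aff_op g y)
  end.

Lemma site_op_action : is_action site_op.
Proof.
have [v1 vM] := vertex_op_action hp hq; have [a1 aM] := aff_op_action hp hq.
split=> [[[u w]|[m y]]|g h [[u w]|[m y]]] /=; by rewrite ?v1 ?vM ?a1 ?aM.
Qed.

(** width m is chosen so that height m * width m times the square of this number
    is 2^m. *)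
Definition bump_height (m : nat) : R := ((height m * step_bound p q m)%:R)^-1.

Definition potential (i : site) : R :=
  match i with
  | inl (u, w) => (vparent u w)%:R
  | inr (m, y) => (y \in folner p q m)%:R * bump_height m
  end.

Local Notation cob := (coboundary site_op potential).

Lemma sqr_indicator_diff (b b' : bool) (h : R) :
  (b%:R * h - b'%:R * h) ^+ 2 = (b != b')%:R * h ^+ 2.
Proof.
by case: b; case: b'; rewrite ?mul0r ?mul1r ?subrr ?subr0 ?sub0r ?sqrrN ?expr0n.
Qed.

Lemma bump_heightE m : bump_height m = (4 ^+ m * (step_bound p q m)%:R)^-1.
Proof. by rewrite /bump_height natrM /height natrX. Qed.

Lemma bump_weight_x m :
  bump_height m ^+ 2 *+ size (folner_boundary_x p q m) <= 4 / 2 ^+ m.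
Proof.
rewrite size_cat !size_allpairs !size_iota -mulr_natl natrD !natrM.
rewrite /bump_height natrM; set N := (height m)%:R : R.
set C := (step_bound p q m)%:R : R.
have N0 : 0 < N by rewrite ltr0n expn_gt0.
have C1 : 1 <= C by rewrite ler1n step_bound_gt0.
have C0 : 0 < C by exact: lt_le_trans C1.
have -> : (N * (2 * C) + N * (2 * C)) * (N * C)^-1 ^+ 2 = 4 / (N * C).
  by field; rewrite !lt0r_neq0.
rewrite ler_pM2l // lef_pV2 ?posrE ?mulr_gt0 ?exprn_gt0 //.
apply: le_trans (_ : N <= _); last by rewrite ler_peMr // ltW.
by rewrite /N natrX lerXn2r ?nnegrE // ler_nat.
Qed.

Lemma bump_weight_t m :
  bump_height m ^+ 2 *+ size (folner_boundary_t p q m) <= 4 / 2 ^+ m.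
Proof.
rewrite size_allpairs size_iota -mulr_natl natrM /= bump_heightE.
rewrite /width; move: (step_bound_gt0 hp hq m); move: (step_bound p q m) => c c0.
rewrite natrM natrX natrX natrM natrX; set C := c%:R : R.
have C0 : C != 0 by rewrite pnatr_eq0 -lt0n.
have T0 : 2%:R ^+ m != 0 :> R by rewrite expf_neq0 // pnatr_eq0.
have -> : (4 : R) ^+ m = 2%:R ^+ m * 2%:R ^+ m by rewrite -exprMn -natrM.
have -> : 2 * (2%:R ^+ m * (2%:R ^+ m * C) ^+ 2) *
    (2%:R ^+ m * 2%:R ^+ m * C)^-1 ^+ 2 = 2 / 2%:R ^+ m :> R.
  by field; rewrite C0 T0.
by rewrite ler_pM2r ?invr_gt0 ?exprn_gt0 // ler_nat.
Qed.

Lemma sum_geometric_le n : \sum_(m < n) 4 / 2 ^+ m <= 8 :> R.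
Proof.
suff -> : \sum_(m < n) 4 / 2 ^+ m = 8 - 8 / 2 ^+ n :> R.
  by rewrite gerBl mulr_ge0 // invr_ge0 exprn_ge0.
elim: n => [|n IHn]; first by rewrite big_ord0 expr0 divr1 subrr.
rewrite big_ord_recr /= IHn exprS.
by field; rewrite expf_neq0 // pnatr_eq0.
Qed.

Lemma bump_norm m :
  bump_height m ^+ 2 *+ size (folner p q m) = 2 ^+ m.
Proof.
rewrite size_folner -mulr_natl natrM bump_heightE /width.
move: (step_bound_gt0 hp hq m); move: (step_bound p q m) => c c0.
rewrite /height natrX natrM natrX natrX natrM natrX; set C := c%:R : R.
have C0 : C != 0 by rewrite pnatr_eq0 -lt0n.
have T0 : 2%:R ^+ m != 0 :> R by rewrite expf_neq0 // pnatr_eq0.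
have -> : (4 : R) ^+ m = 2%:R ^+ m * 2%:R ^+ m by rewrite -exprMn -natrM.
by field; rewrite C0 T0.
Qed.

(** The layers are at most two tree edges, of weight 1, and then for each m the
    part of the m-th Folner set moved by g.  The bound is 10 = 2 + 8. *)
Lemma coboundary_layers g (e : seq (vertex * vertex)) (B : nat -> seq (int * rat)) :
    (size e <= 2)%N ->
    (forall u w, vparent (vertex_op g^-1%g u) (vertex_op g^-1%g w) != vparent u w ->
      (u, w) \in e) ->
    (forall m y, (aff_op g^-1%g y \in folner p q m) != (y \in folner p q m) ->
      y \in B m) ->
    (forall m, bump_height m ^+ 2 *+ size (B m) <= 4 / 2 ^+ m) ->
  cob g \in @l2_pred R site.
Proof.
move=> e2 ge gB wB; apply/asboolP; exists 10.
pose S m : seq site := if m is m'.+1 then [seq inr (m', y) | y <- B m']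
                       else [seq inl uw | uw <- e].
pose w m : R := if m is m'.+1 then bump_height m' ^+ 2 else 1.
apply: (@sq_bounded_layers _ _ _ _ S w).
- by case=> [|m] /=; rewrite ?sqr_ge0.
- case=> [[u v]|[m y]].
    have E : cob g (inl (u, v)) =
        (vparent (vertex_op g^-1%g u) (vertex_op g^-1%g v))%:R * 1
        - (vparent u v)%:R * 1 by rewrite !mulr1.
    rewrite -sqrf_eq0 E sqr_indicator_diff.
    case: (boolP (vparent _ _ != vparent _ _)) => [ne _|_]; last first.
      by rewrite mul0r eqxx.
    exists 0; rewrite /= mul1r expr1n; split=> //.
    by apply: map_f; exact: ge.
  have E : cob g (inr (m, y)) =
      (aff_op g^-1%g y \in folner p q m)%:R * bump_height m
      - (y \in folner p q m)%:R * bump_height m by [].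
  rewrite -sqrf_eq0 E sqr_indicator_diff.
  case: (boolP ((_ \in _) != (_ \in _))) => [ne _|_]; last first.
    by rewrite mul0r eqxx.
  exists m.+1; rewrite /= mul1r; split=> //.
  by apply: map_f; exact: gB.
- case=> [|n]; first by rewrite big_ord0.
  rewrite big_ord_recl /= size_map.
  have h1 : (size e)%:R <= 2 :> R by rewrite ler_nat.
  have h2 : \sum_(i < n) w (bump 0 i) *+ size (S (bump 0 i)) <= 8.
    apply: le_trans (sum_geometric_le n); apply: ler_sum => i _.
    by rewrite /= size_map.
  lra.
Qed.

(** The generator x fixes the base vertex, so the tree does not contribute. *)
Lemma coboundary_gx : cob (gx p q) \in @l2_pred R site.
Proof.
have xE : ((gx p q)^-1 = gX p q (-1))%g by rewrite gXN.
apply: (@coboundary_layers _ [::] (folner_boundary_x p q)) => //.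
- by move=> u w; rewrite xE !vertex_op_gX // vparent_x // eqxx.
- by move=> m y; rewrite xE aff_op_gX //; exact: folner_xP.
- exact: bump_weight_x.
Qed.

Lemma coboundary_gt : cob (gt p q) \in @l2_pred R site.
Proof.
pose v1 := vertex_t true (base_vertex p q).
have base (u w : vertex) : base_edge false (val u) (val w) ->
    u = base_vertex p q /\ w = v1.
  by move=> /andP[/eqP u0 /eqP w0]; split; apply: val_inj.
apply: (@coboundary_layers _ [:: (base_vertex p q, v1); (v1, base_vertex p q)]
  (folner_boundary_t p q)) => //.
- move=> u w; rewrite !vertex_op_gtV // !inE.
  have [/base[-> ->]|b1] := boolP (base_edge false (val u) (val w)).
    by rewrite eqxx.
  have [/base[-> ->]|b2] := boolP (base_edge false (val w) (val u)).
    by rewrite eqxx orbT.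
  by rewrite /vparent /= (parent_list_t (valP u) (valP w)) ?eqxx.
- by move=> m y; rewrite aff_op_gtV //; exact: folner_tP.
- exact: bump_weight_t.
Qed.

Lemma coboundary_l2 g : cob g \in @l2_pred R site.
Proof.
have act := site_op_action.
elim/presented_ind: g => [|a g IH|a g IH].
- by rewrite coboundary1 //; exact: rpred0.
- by apply: l2_coboundaryM => //; case: a; [exact: coboundary_gx|exact: coboundary_gt].
- apply: l2_coboundaryM => //; apply: l2_coboundaryV => //.
  by case: a; [exact: coboundary_gx|exact: coboundary_gt].
Qed.

(** Each edge of the geodesic between the two positions of the base vertex
    contributes 1 to the square norm. *)
Lemma coboundary_base_le M g :
  sq_bounded M (cob g) -> (size (val (vertex_op g (base_vertex p q))))%:R <= M.
Proof.
set v := vertex_op g (base_vertex p q); set d := size (val v) => gM.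
pose s : seq site := [seq inl (ancestor v k, ancestor v k.+1) | k <- iota 0 d].
have s_uniq : uniq s.
  rewrite map_inj_in_uniq ?iota_uniq // => i j; rewrite !mem_iota /= => id jd.
  case=> /(congr1 size) /=; rewrite !size_takel //; exact: ltnW.
apply: le_trans (sq_bounded_uniq gM s_uniq); rewrite big_map.
rewrite (eq_big_seq (fun=> 1)); last first.
  move=> k; rewrite mem_iota /= => kd.
  have := vparent_ancestor kd; have := vparent_geodesic hp hq kd.
  rewrite /coboundary /= => /vparent_asym /negbTE -> ->.
  by rewrite sub0r sqrrN expr1n.
by rewrite big_const_seq count_predT size_iota iter_addr_0.
Qed.

(** One copy suffices: if 2^m > M and |k| is at least the width of A_m, then A_m is
    disjoint from its translate and the square norm is at least 2^m. *)
Lemma coboundary_gX_finite M : finite_set [set k | sq_bounded M (cob (gX p q k))].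
Proof.
have [m Mm] : exists m, M < 2 ^+ m.
  exists (Num.truncn M).+1.
  apply: lt_trans (truncnS_gt M) _.
  by rewrite -natrX ltr_nat ltn_expl.
apply: (@sub_finite_set _ _ [set k%:Z - (width p q m)%:Z | k in `I_((width p q m).*2)]).
  move=> k /= kM.
  have [far|near] := leqP (width p q m) `|k|%N; last first.
    by exists (absz (k + (width p q m)%:Z)); lia.
  pose s : seq site := [seq inr (m, y) | y <- folner p q m].
  have s_uniq : uniq s by rewrite map_inj_uniq ?uniq_folner // => y z [].
  have := sq_bounded_uniq kM s_uniq; rewrite big_map.
  rewrite (eq_big_seq (fun=> bump_height m ^+ 2)); last first.
    move=> y yA; rewrite /coboundary /= -gXN aff_op_gX // yA.
    by rewrite (negbTE (folner_displaced _ _ _ yA)) ?abszN // mul0r sub0r mul1r sqrrN.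
  rewrite big_const_seq count_predT iter_addr_0 bump_norm.
  by rewrite leNgt Mm.
by apply: finite_image; exact: finite_II.
Qed.

(** A bound on the coboundary of g confines g to finitely many cosets c <x>.  If
    g = c x^k with c fixed, then it bounds the coboundary of x^k = c^-1 g. *)
Lemma coboundary_proper M : finite_set [set g | sq_bounded M (cob g)].
Proof.
have act := site_op_action.
pose c (v : vertex) := section_word p q (val v).
have /choice[N NP] : forall v, exists N, sq_bounded N (cob (c v)^-1%g).
  by move=> v; exact/asboolP/coboundary_l2.
pose ball := [set v : vertex | (size (val v) <= Num.truncn M)%N].
pose K v := [set k | sq_bounded (2 * M + 2 * N v) (cob (gX p q k))].
have fin : finite_set (\bigcup_(v in ball) [set (c v * gX p q k)%g | k in K v]).
  apply: bigcup_finite; first exact: finite_ball.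
  by move=> v _; apply: finite_image; exact: coboundary_gX_finite.
apply: sub_finite_set fin => g /= gM.
have [k gE] := coset_of_vertex hp hq g; set v := vertex_op g _ in gE.
exists v; last first.
  exists k; last exact/esym.
  rewrite /K /mkset.
  have -> : gX p q k = ((c v)^-1 * g)%g by rewrite [in RHS]gE mulKg.
  rewrite coboundaryM //; apply: sq_boundedD => //.
  by apply: sq_bounded_comp gM; apply: can_inj (opVK act _).
rewrite /ball /= -ltnS -(ltr_nat R).
exact: le_lt_trans (coboundary_base_le gM) (truncnS_gt M).
Qed.

End BaumslagSolitarWalls.

Theorem mainTheorem3 (R : realType) (p q : int) (hp : p != 0) (hq : q != 0) :
  a_T_menable R (BS p q).
Proof.
apply: (@a_T_menable_of_coboundary R (site p q) _ (@site_op p q) _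
  (@potential R p q)).
- exact: site_op_action.
- exact: coboundary_l2.
- exact: coboundary_proper.
Qed.
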